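(* Let $1/2\le\underline{s}\le\overline{s}<1$ and let $\mu$ be a probability measure on $\mathbb{R}$ supported in $[\underline{s},\overline{s}]$, i.e. $\mu\ge0$ and $\mu([\underline{s},\overline{s}])=\mu(\mathbb{R})=1$. Let $L$ be the nonlocal operator on functions on $\mathbb{R}$ given by $Lu=\int_{\underline{s}}^{\overline{s}}(-\Delta)^su\,d\mu(s)$. Assume that $c:\mathbb{R}\to\mathbb{R}$ is bounded, that there are positive constants $c_0,R_0$ such that $c(x)\le-c_0<0$ for $x\in\mathbb{R}\setminus[-R_0,R_0]$, and that $\|c\|_{C^{1,2\overline{s}-1}(\mathbb{R})}<+\infty$. Let $w$ and $\widetilde w$ be two bounded solutions of the linear equation $L\varphi-c(x)\varphi=0$ in $\mathbb{R}$, with $w>0$ in $\mathbb{R}$. Then $\widetilde w/w$ is constant in $\mathbb{R}$.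
   Context: All functions are real valued on $\mathbb{R}$. The fractional Laplacian is $(-\Delta)^su(x)=\mathrm{P.V.}\int_{\mathbb{R}}\frac{u(x)-u(y)}{|x-y|^{1+2s}}\,dy$ (no normalizing constant), so that $Lu(x)=\mathrm{P.V.}\int_{\mathbb{R}}(u(x)-u(y))K(x-y)\,dy$ with $K(z)=\int_{\underline{s}}^{\overline{s}}|z|^{-1-2s}\,d\mu(s)$; P.V. denotes $\lim_{\varepsilon\to0^+}$ of the integral over $\{|x-y|>\varepsilon\}$. Solutions are understood as functions of class $C^{1,\alpha}$ ($C^1$ with locally $\alpha$-Hölder derivative) for some $\alpha>2\overline{s}-1$ satisfying the equation pointwise at every $x\in\mathbb{R}$. $\|c\|_{C^{1,\beta}(\mathbb{R})}$ is the global $C^{1,\beta}$ norm on $\mathbb{R}$ (with $C^{1,0}=C^1$). *)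

(* Defs.v *)
From HB Require Import structures.
From mathcomp Require Import all_boot all_order all_algebra.
From mathcomp Require Import all_classical all_reals all_analysis.

Set Implicit Arguments.
Unset Strict Implicit.
Unset Printing Implicit Defensive.

Import Order.TTheory GRing.Theory Num.Theory.
Import numFieldNormedType.Exports.

Local Open Scope classical_set_scope.
Local Open Scope ring_scope.

Definition is_C1 (R : realType) (f : R -> R) : Prop :=
  (forall x : R, derivable f x 1) /\ continuous (derive1 f).

Definition sup_norm (R : realType) (f : R -> R) : \bar R :=
  ereal_sup [set `|f x|%:E | x in [set: R]].

Definition holder_seminorm (R : realType) (beta : R) (f : R -> R) : \bar R :=
  ereal_sup [set (`|f p.1 - f p.2| / `|p.1 - p.2| `^ beta)%:E
            | p in [set p : R * R | p.1 != p.2]].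

(* The global C^{1,beta} norm of a C^1 function; C^{1,0} is C^1. *)
Definition C1_holder_norm (R : realType) (beta : R) (f : R -> R) : \bar R :=
  (sup_norm f + sup_norm (derive1 f) +
   (if beta == 0%R then 0 else holder_seminorm beta (derive1 f)))%E.

Definition locally_holder (R : realType) (alpha : R) (f : R -> R) : Prop :=
  forall r : R, exists M : R, forall x y : R,
    x \in `[- r, r] -> y \in `[- r, r] ->
    `|f x - f y| <= M * `|x - y| `^ alpha.

Definition is_C1_holder (R : realType) (alpha : R) (f : R -> R) : Prop :=
  is_C1 f /\ locally_holder alpha (derive1 f).

(* The principal value, without normalizing constant. The limit exists for u
   bounded and of class C^{1,alpha} with 0 < s < 1 and 2 * s - 1 < alpha. *)
Definition frac_laplacian (R : realType) (s : R) (u : R -> R) (x : R) : R :=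
  lim ((\int[lebesgue_measure]_(y in [set y : R | eps < `|x - y|])
          ((u x - u y) / `|x - y| `^ (1 + 2 * s))) @[eps --> 0^'+]).

(* For u bounded and of class C^{1,alpha} with alpha > 2 * s2 - 1, the integrand
   is a bounded Borel function of s on [s1, s2] whenever 0 < s1 <= s2 < 1. *)
Definition mixed_laplacian (R : realType)
    (mu : probability (measurableTypeR R) R) (s1 s2 : R)
    (u : R -> R) (x : R) : R :=
  \int[mu]_(s in `[s1, s2]) frac_laplacian s u x.

(* Solutions of L phi - c phi = 0 in R, where L = mixed_laplacian mu s1 s2. *)
Definition is_solution (R : realType)
    (mu : probability (measurableTypeR R) R) (s1 s2 : R)
    (c : R -> R) (phi : R -> R) : Prop :=
  (exists alpha : R, [/\ 2 * s2 - 1 < alpha, alpha <= 1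
                       & is_C1_holder alpha phi]) /\
  (forall x : R, mixed_laplacian mu s1 s2 phi x - c x * phi x = 0).

(* Main.v *)
Require Import Defs.
From HB Require Import structures.
From mathcomp Require Import all_boot all_order all_algebra.
From mathcomp Require Import all_classical all_reals all_analysis.
From mathcomp Require Import measurable_realfun ring lra.

Set Implicit Arguments.
Unset Strict Implicit.
Unset Printing Implicit Defensive.

Import Order.TTheory GRing.Theory Num.Theory.
Import numFieldNormedType.Exports.

Local Open Scope classical_set_scope.
Local Open Scope ring_scope.

(** The proof compares the two solutions through the extreme value of their
    ratio.  Let [k] be the maximum of [wt / w] over [[- R0, R0]], attained at
    [x0], and let [v = wt - k w].  Then [v] is a bounded solution of the same
    equation, [v <= 0] on [[- R0, R0]] and [v x0 = 0].

    The maximum principle [maximum_principle] extends [v <= 0] to the whole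
    line.  If [M = sup v] were positive, [v] would exceed [M - d] somewhere,
    and adding a bump of height [2 d] there makes the perturbed function attain
    its maximum, at a point [x1] with [v x1 > M - d].  At a maximum the operator
    is nonnegative and it is bounded on the bump uniformly in its position, so
    [L v x1 >= - 2 d K]; but [x1] lies outside [[- R0, R0]], hence
    [L v x1 = c x1 * v x1 <= - c0 (M - d)], which is impossible for small [d].

    So [v] attains its maximum [0] at [x0], where [L v x0 = c x0 * v x0 = 0].
    The integrand defining [L v x0] is nonnegative, and vanishing of the
    integral forces [v = 0] ([strong_maximum_principle]), that is [wt = k w].

    Analytically, everything is done on the second difference
    [sdiff u x z = 2 u x - u (x + z) - u (x - z)].  For [u] bounded with a
    locally [a]-Hoelder derivative it is [O(z^(1 + a))] at [0], so
    [sdiff u x z / z^(1 + 2 s)] is absolutely integrable on [z > 0] and the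
    principal value is its ordinary integral ([frac_laplacianE]).  The bound by
    an integrable [majorant] is uniform for [s] near [[s1, s2]]; by dominated
    convergence the integral is continuous in [s], hence integrable against
    [mu], which makes the mixed operator linear and monotone. *)

(** * An integrable majorant for the kernels *)

(** Exhausting the half-line by segments, on which the fundamental theorem of
    calculus applies, avoids any discussion of the two improper ends. *)
Lemma integrable_bounded_primitive (R : realType) (f F : R -> R) (M : R) :
  (forall x : R, 0 < x -> 0 <= f x) ->
  {in `]0, +oo[, continuous f} ->
  (forall x : R, 0 < x -> is_derive x 1 F (f x)) ->
  (forall x : R, 0 < x -> `|F x| <= M) ->
  lebesgue_measure.-integrable `]0, +oo[ (EFin \o f).
Proof.
move=> f0 cf dF FM.
pose I n := [set` `[(n.+1%:R)^-1 : R, n.+2%:R]].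
have I0 n x : I n x -> 0 < x.
  rewrite /I/= in_itv/= => /andP[+ _]; apply: lt_le_trans.
  by rewrite invr_gt0 ltr0n.
have ndI : nondecreasing_seq I.
  move=> m n mn; rewrite subsetEset => x; rewrite /I/= !in_itv/= => /andP[mx xm].
  rewrite (le_trans _ mx) ?lef_pV2 ?posrE ?ltr0n ?ler_nat//=.
  by rewrite (le_trans xm)// ler_nat !ltnS.
have bigI : \bigcup_i I i = `]0, +oo[%classic.
  apply/seteqP; split=> [x [n _ /I0 x0]|x]; first by rewrite /= in_itv/= x0.
  rewrite /= in_itv/= andbT => x0.
  have [n xn] : exists n : nat, x <= n%:R.
    by exists (Num.truncn x).+1; rewrite ltW// truncnS_gt.
  have [m xm] : exists m : nat, x^-1 <= m%:R.
    by exists (Num.truncn x^-1).+1; rewrite ltW// truncnS_gt.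
  exists (maxn m n) => //; rewrite /I/= in_itv/=; apply/andP; split.
    rewrite -[leRHS]invrK lef_pV2 ?posrE ?ltr0n ?invr_gt0//.
    by rewrite (le_trans xm)// ler_nat (leq_trans (leq_maxl m n)).
  by rewrite (le_trans xn)// ler_nat (leq_trans (leq_maxr m n))// leqW// leqW.
have mf : measurable_fun `]0:R, +oo[ f.
  apply: open_continuous_measurable_fun => [|x]; first exact: interval_open.
  by rewrite inE => /cf.
apply/integrableP; split; first exact/measurable_EFinP.
have -> : (\int[lebesgue_measure]_(x in `]0%R, +oo[) `|(EFin \o f) x| =
    \int[lebesgue_measure]_(x in `]0%R, +oo[) (f x)%:E)%E.
  apply: eq_integral => x; rewrite inE/= in_itv/= andbT => x0.
  by rewrite ger0_norm// f0.
have cvgI : (\int[lebesgue_measure]_(x in I n) (f x)%:E @[n --> \oo]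
    --> \int[lebesgue_measure]_(x in `]0%R, +oo[) (f x)%:E)%E.
  rewrite -bigI; apply: ge0_nondecreasing_set_cvg_integral => //.
  - by move=> n; exact: measurable_itv.
  - move=> n; apply: measurableT_comp => //; apply: measurable_funS mf => // x /I0 x0.
    by rewrite /= in_itv/= x0.
  - by move=> n x /I0 x0; rewrite lee_fin f0.
apply: (@le_lt_trans _ _ (M + M)%:E); last exact: ltry.
apply: (cvge_le _ cvgI); apply: nearW => n.
have ltI : (n.+1%:R)^-1 < n.+2%:R :> R.
  rewrite (@le_lt_trans _ _ 1)// ?ltr1n//.
  by rewrite invf_le1 ?ltr0n// ler1n.
have cF x : 0 < x -> {for x, continuous F}.
  by move=> x0; apply/differentiable_continuous/derivable1_diffP; case: (dF _ x0).
have p0 : 0 < (n.+1%:R)^-1 :> R by rewrite invr_gt0 ltr0n.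
rewrite (@continuous_FTC2 _ f F)//.
- rewrite -EFinB lee_fin; apply: lerD.
    by rewrite (le_trans (ler_norm _))// FM// ltr0n.
  by rewrite (le_trans (ler_norm _))// normrN FM.
- apply: continuous_in_subspaceT => x; rewrite inE => /I0 x0; apply: cf.
  by rewrite in_itv/= x0.
- split.
  + move=> x; rewrite in_itv/= => /andP[/(lt_trans p0) x0 _].
    by case: (dF _ x0).
  + by apply: cvg_at_right_filter; exact: cF.
  + by apply: cvg_at_left_filter; apply: cF; rewrite ltr0n.
- move=> x; rewrite in_itv/= => /andP[/(lt_trans p0) x0 _].
  by rewrite derive1E; case: (dF _ x0).
Qed.

(** The derivative of [- (1 + z^t)^-1]: up to a constant it is the smaller of
    [z^(t - 1)] and [z^(- t - 1)], so one exponent controls both ends of the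
    half-line. *)
Definition majorant (R : realType) (t z : R) : R :=
  t * z `^ (t - 1) / (1 + z `^ t) ^+ 2.

Lemma majorant_ge0 (R : realType) (t z : R) : 0 <= t -> 0 <= majorant t z.
Proof.
by move=> t0; rewrite divr_ge0 ?sqr_ge0// mulr_ge0// powR_ge0.
Qed.

Lemma powR_continuous (R : realType) (p x : R) : 0 < x ->
  {for x, continuous (@powR R ^~ p)}.
Proof.
move=> x0; apply/differentiable_continuous/derivable1_diffP.
by apply: derivable_powR; rewrite in_itv/= x0.
Qed.

Lemma majorant_integrable (R : realType) (t : R) : 0 < t ->
  lebesgue_measure.-integrable `]0, +oo[ (EFin \o majorant t).
Proof.
move=> t0.
have den x : 1 + x `^ t != 0 :> R by rewrite gt_eqF// ltr_wpDr ?powR_ge0.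
apply: (@integrable_bounded_primitive _ _ (fun x => - (1 + x `^ t)^-1) 1).
- by move=> x x0; apply: majorant_ge0; exact: ltW.
- move=> x; rewrite in_itv/= andbT => x0.
  apply: cvgM; first by apply: cvgM; [exact: cvg_cst|exact: powR_continuous].
  apply: cvgV; first by rewrite expf_neq0.
  rewrite expr2; apply: cvgM; apply: cvgD; by [exact: cvg_cst|exact: powR_continuous].
- move=> x x0.
  have d : is_derive x 1 (fun y => 1 + y `^ t) (t * x `^ (t - 1)).
    have -> : (fun y => 1 + y `^ t) = cst 1 + (@powR R ^~ t) by [].
    have := is_deriveD (is_derive_cst (1:R) x 1) (is_derive1_powR t x0).
    by rewrite add0r.
  have := is_deriveN (@is_deriveV _ (fun y => 1 + y `^ t) _ _ _ (den x) d).
  by rewrite scaleNr opprK [_ *: _]mulrC.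
- move=> x x0; rewrite normrN normfV ger0_norm; last by rewrite addr_ge0// powR_ge0.
  rewrite invf_le1; first by rewrite lerDl powR_ge0.
  by rewrite ltr_wpDr// powR_ge0.
Qed.

Lemma majorant_near0 (R : realType) (t z : R) : 0 < t -> 0 < z -> z <= 1 ->
  z `^ (t - 1) <= 4 / t * majorant t z.
Proof.
move=> t0 z0 z1.
have zt : z `^ t <= 1.
  by rewrite -[leRHS](powRr0 z) ger_powR ?z0// ltW.
have p := powR_ge0 z t.
rewrite /majorant !mulrA divfK ?gt_eqF// ler_pdivlMr; last first.
  by rewrite exprn_gt0// ltr_wpDr.
rewrite [leRHS]mulrC ler_wpM2l ?powR_ge0//.
nra.
Qed.

Lemma majorant_nearoo (R : realType) (t z : R) : 0 < t -> 1 <= z ->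
  z `^ (- t - 1) <= 4 / t * majorant t z.
Proof.
move=> t0 z1; have z0 : 0 < z by exact: lt_le_trans z1.
have zt : 1 <= z `^ t.
  by rewrite -[leLHS](powRr0 z) ler_powR// ltW.
have p := powR_ge0 z (- t - 1).
have -> : 4 / t * majorant t z
    = 4 * (z `^ t * z `^ t * z `^ (- t - 1)) / (1 + z `^ t) ^+ 2.
  have <- : z `^ (t - 1) = z `^ t * z `^ t * z `^ (- t - 1).
    rewrite -!powRD ?(gt_eqF z0) ?implybT//; congr (_ `^ _).
    ring.
  by rewrite /majorant !mulrA divfK ?gt_eqF.
rewrite ler_pdivlMr; last by rewrite exprn_gt0// ltr_wpDr// powR_ge0.
have -> : 4 * (z `^ t * z `^ t * z `^ (- t - 1))
  = z `^ (- t - 1) * (4 * (z `^ t * z `^ t)) by ring.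
rewrite ler_wpM2l//; nra.
Qed.

(** * Second differences and the principal value *)

Lemma integrable_setU d (T : measurableType d) (R : realType)
    (mu : {measure set T -> \bar R}) (A B : set T) (f : T -> \bar R) :
  measurable A -> measurable B -> [disjoint A & B] ->
  mu.-integrable A f -> mu.-integrable B f -> mu.-integrable (A `|` B) f.
Proof.
move=> mA mB AB /integrableP[mfA fA] /integrableP[mfB fB].
have mf : measurable_fun (A `|` B) f by apply/measurable_funU.
apply/integrableP; split => //.
rewrite ge0_integral_setU//; last exact: measurableT_comp.
by rewrite lte_add_pinfty.
Qed.

Definition sdiff (R : realType) (u : R -> R) (x z : R) : R :=
  2 * u x - u (x + z) - u (x - z).

Definition kernel_integral (R : realType) (s : R) (u : R -> R) (x : R) : R :=
  \int[lebesgue_measure]_(z in `]0, +oo[) (sdiff u x z / z `^ (1 + 2 * s)).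

(** What is used of a bounded [C^(1, a)] function.  Unlike Hoelder continuity of
    the derivative, these conditions are visibly stable under linear
    combinations. *)
Definition admissible (R : realType) (a : R) (u : R -> R) : Prop :=
  [/\ continuous u, exists M : R, forall x, `|u x| <= M
    & forall x, exists C : R, forall z, 0 < z -> z <= 1 ->
        `|sdiff u x z| <= C * z `^ (1 + a)].

Section kernel.
Context {R : realType}.
Implicit Types (a s t x z : R) (u v : R -> R).
Local Notation leb := (@lebesgue_measure R).

(** The bound [C z^(1 + a)] is what the kernel needs near [0], the bound [C]
    near infinity; the conditions on [t] say that [t - 1 <= a - 2 s] and
    [- 1 - 2 s <= - t - 1]. *)
Lemma kernel_bound s a t C d z : 0 < t -> t <= a + 1 - 2 * s -> t <= 2 * s ->
  0 < z -> `|d| <= C -> (z <= 1 -> `|d| <= C * z `^ (1 + a)) ->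
  `|d / z `^ (1 + 2 * s)| <= C * (4 / t * majorant t z).
Proof.
move=> t0 tas ts z0 dC dCz; have C0 : 0 <= C by exact: le_trans dC.
rewrite normrM [X in _ * X]ger0_norm ?invr_ge0 ?powR_ge0// -powRN.
have [z1|/ltW z1] := leP z 1.
- apply: (@le_trans _ _ (C * z `^ (1 + a) * z `^ (- (1 + 2 * s)))).
    by rewrite ler_wpM2r ?powR_ge0// dCz.
  rewrite -mulrA ler_wpM2l// -powRD ?(gt_eqF z0) ?implybT//.
  apply: le_trans (majorant_near0 t0 z0 z1); rewrite ger_powR ?z0//; lra.
- apply: (@le_trans _ _ (C * z `^ (- (1 + 2 * s)))).
    by rewrite ler_wpM2r ?powR_ge0.
  rewrite ler_wpM2l//; apply: le_trans (majorant_nearoo t0 z1).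
  rewrite ler_powR//; lra.
Qed.

Lemma sdiff_bound a u x : admissible a u ->
  exists2 C : R, 0 <= C & forall s t z,
    0 < t -> t <= a + 1 - 2 * s -> t <= 2 * s -> 0 < z ->
    `|sdiff u x z / z `^ (1 + 2 * s)| <= C * (4 / t * majorant t z).
Proof.
move=> [_ [M uM] /(_ x)[C uC]].
have M0 : 0 <= M by exact: le_trans (uM 0).
exists (Num.max (4 * M) C); first by rewrite le_max mulr_ge0.
move=> s t z t0 tas ts z0; apply: (kernel_bound t0 tas ts z0).
  rewrite le_max; apply/orP; left.
  have := uM x; have := uM (x + z); have := uM (x - z).
  rewrite /sdiff !ler_norml => /andP[? ?] /andP[? ?] /andP[? ?].
  by apply/andP; split; lra.
move=> z1; apply: (le_trans (uC _ z0 z1)).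
by rewrite ler_wpM2r ?powR_ge0// le_max lexx orbT.
Qed.

Lemma sdiff_continuous u x : continuous u -> continuous (sdiff u x).
Proof.
move=> cu z; apply: cvgB; first apply: cvgB.
- exact: cvg_cst.
- apply: (@continuous_comp _ _ _ (fun z => x + z) u); last exact: cu.
  by apply: cvgD; [exact: cvg_cst|exact: cvg_id].
- apply: (@continuous_comp _ _ _ (fun z => x - z) u); last exact: cu.
  by apply: cvgB; [exact: cvg_cst|exact: cvg_id].
Qed.

Lemma measurable_pos : measurable (`]0, +oo[ : set R).
Proof. exact: measurable_itv. Qed.

Lemma measurable_kernel s (f : R -> R) :
  measurable_fun setT f ->
  measurable_fun setT (fun z => f z / z `^ (1 + 2 * s)).
Proof.
move=> mf; apply: measurable_funM => //.
under eq_fun do rewrite -powRN.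
exact: measurable_powR.
Qed.

Lemma kernel_integrable a s t u x : admissible a u ->
  0 < t -> t <= a + 1 - 2 * s -> t <= 2 * s ->
  leb.-integrable `]0, +oo[
    (EFin \o (fun z => sdiff u x z / z `^ (1 + 2 * s))).
Proof.
move=> au t0 tas ts; have [C C0 uC] := sdiff_bound x au.
have : leb.-integrable `]0, +oo[
    (fun z => (C * (4 / t))%:E * (EFin \o majorant t) z)%E.
  by apply: integrableZl => //; exact: majorant_integrable.
apply: le_integrable => //.
- apply: measurableT_comp => //; apply: measurable_funTS.
  apply: measurable_kernel; apply: continuous_measurable_fun.
  by apply: sdiff_continuous; case: au.
- move=> z; rewrite /= in_itv/= andbT => z0; rewrite lee_fin.
  by rewrite -mulrA (le_trans (uC s _ _ t0 tas ts z0))// ler_norm.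
Qed.

(** The substitutions [y = x + z] and [y = x - z] fold the two half-lines
    [y > x + e] and [y < x - e] onto [z > e]. *)
Lemma lebesgue_measure_shift x (A : set R) : measurable A ->
  pushforward leb (fun z => x + z : measurableTypeR R) A = leb A.
Proof.
move=> mA.
have mphi : measurable_fun [set: measurableTypeR R] (fun z => x + z : measurableTypeR R).
  exact: measurable_funD.
apply/esym/lebesgue_measure_unique => //= _ [[p q]] _ <-.
rewrite /pushforward (_ : _ @^-1` _ = `]p - x, q - x]%classic); last first.
  by apply/seteqP; split=> z /=; rewrite !in_itv/= ltrBlDl lerBrDl.
by rewrite !lebesgue_measure_itv/= !lte_fin ltrD2r -!EFinB opprB addrA subrK.
Qed.

Lemma lebesgue_measure_reflect x (A : set R) : measurable A ->
  pushforward leb (fun z => x - z : measurableTypeR R) A = leb A.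
Proof.
move=> mA.
have mphi : measurable_fun [set: measurableTypeR R] (fun z => x - z : measurableTypeR R).
  exact: measurable_funB.
apply/esym/lebesgue_measure_unique => //= _ [[p q]] _ <-.
rewrite /pushforward (_ : _ @^-1` _ = `[x - q, x - p[%classic); last first.
  apply/seteqP; split=> z /=; rewrite !in_itv/=.
    by move=> /andP[? ?]; apply/andP; split; lra.
  by move=> /andP[? ?]; apply/andP; split; lra.
rewrite !lebesgue_measure_itv/= !lte_fin ltrD2l ltrN2 -!EFinB.
by congr (if _ then _%:E else _); ring.
Qed.

End kernel.

Section principal_value.
Context {R : realType}.
Implicit Types (a s t x z : R) (u v : R -> R).
Local Notation leb := (@lebesgue_measure R).

Lemma tail_integrable s e M (f : R -> R) : 0 < s -> 0 < e ->
  measurable_fun setT f -> (forall z, `|f z| <= M) ->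
  leb.-integrable `]e, +oo[ (EFin \o (fun z => f z / z `^ (1 + 2 * s))).
Proof.
move=> s0 e0 mf fM; have M0 : 0 <= M by exact: le_trans (fM 0).
(* The kernel is cut off below [e], so the exponent at [0] is a free choice;
   [2 s] gives the constant [M / e^(1 + 2 s)]. *)
pose t := Num.min 1 (2 * s).
have t0 : 0 < t by rewrite lt_min ltr01 mulr_gt0.
have t1 : t <= 1 by rewrite ge_min lexx.
have ts : t <= 2 * s by rewrite ge_min lexx orbT.
pose C := Num.max M (M / e `^ (1 + 2 * s)).
have : leb.-integrable `]e, +oo[
    (fun z => (C * (4 / t))%:E * (EFin \o majorant t) z)%E.
  apply: integrableZl => //.
  apply: (integrableS _ _ _ (majorant_integrable t0)) => //.
  by move=> z; rewrite /= !in_itv/= !andbT; exact: lt_trans.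
apply: le_integrable => //.
- by apply: measurableT_comp => //; apply: measurable_funTS; exact: measurable_kernel.
- move=> z; rewrite /= in_itv/= andbT => ez; rewrite lee_fin.
  have z0 : 0 < z by exact: lt_trans ez.
  rewrite -mulrA; apply: le_trans (ler_norm _).
  apply: (kernel_bound (a := 2 * s)) => //; first by lra.
    by rewrite (le_trans (fM z))// le_max lexx.
  move=> z1; rewrite (le_trans (fM z))//.
  apply: (@le_trans _ _ (M / e `^ (1 + 2 * s) * z `^ (1 + 2 * s))).
    rewrite -mulrA ler_peMr// mulrC ler_pdivlMr ?powR_gt0// mul1r.
    by rewrite ge0_ler_powR ?nnegrE ?(ltW e0) ?(ltW z0) ?(ltW ez)//; lra.
  by rewrite ler_wpM2r ?powR_ge0// le_max lexx orbT.
Qed.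

Lemma Rintegral_measure_preserving (phi : measurableTypeR R -> measurableTypeR R)
    (D : set R) (f : R -> R) :
  measurable_fun setT phi ->
  (forall A : set R, measurable A -> pushforward leb phi A = leb A) ->
  measurable D -> measurable_fun setT f ->
  leb.-integrable (phi @^-1` D) (EFin \o (f \o phi)) ->
  leb.-integrable D (EFin \o f) /\
  \int[leb]_(y in D) f y = \int[leb]_(z in phi @^-1` D) f (phi z).
Proof.
move=> mphi pphi mD mf fphi.
have mEf : measurable_fun [set: measurableTypeR R] (EFin \o f).
  exact/measurable_EFinP.
have eqm (g : R -> \bar R) :
    (\int[leb]_(y in D) g y = \int[pushforward leb phi]_(y in D) g y)%E.
  by apply: eq_measure_integral => A mA _; apply/esym; exact: pphi.
split.
  have /integrableP[_] := integrable_pushforward mphi mEf fphi mD.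
  rewrite -eqm => foo; apply/integrableP; split => //.
  exact: measurable_funTS.
by rewrite /Rintegral eqm (integral_pushforward mphi mEf fphi mD).
Qed.

(** Away from the singularity the two sides are separately integrable, so they
    can be folded onto [z > e] and added. *)
Lemma truncated_kernel s e u x : 0 < s -> 0 < e -> continuous u ->
    (exists M, forall y, `|u y| <= M) ->
  \int[leb]_(y in [set y | e < `|x - y|]) ((u x - u y) / `|x - y| `^ (1 + 2 * s))
  = \int[leb]_(z in `]e, +oo[) (sdiff u x z / z `^ (1 + 2 * s)).
Proof.
move=> s0 e0 cu [M uM].
have dis : [disjoint (`]x + e, +oo[%classic : set R) & `]-oo, x - e[%classic].
  apply/disj_setPS => y /=; rewrite !in_itv/= andbT => -[ey ye].
  have := lt_trans ey ye; rewrite ltrD2l => /(lt_trans e0).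
  by rewrite oppr_gt0 ltNge ltW.
pose h y := (u x - u y) / `|x - y| `^ (1 + 2 * s).
have mu_ : measurable_fun [set: measurableTypeR R] u.
  exact: continuous_measurable_fun.
have mh : measurable_fun [set: measurableTypeR R] h.
  apply: measurable_funM; first exact: measurable_funB.
  rewrite (_ : (fun y => _) = (fun z => z `^ (- (1 + 2 * s))) \o
    (fun y => `|x - y|)); last by apply/funext => y /=; rewrite powRN.
  apply: measurableT_comp; first exact: measurable_powR.
  by apply: measurableT_comp => //; exact: measurable_funB.
pose p z : measurableTypeR R := x + z.
pose q z : measurableTypeR R := x - z.
have mp : measurable_fun [set: measurableTypeR R] p by exact: measurable_funD.
have mq : measurable_fun [set: measurableTypeR R] q by exact: measurable_funB.
have -> : [set y | e < `|x - y|] = `]x + e, +oo[%classic `|` `]-oo, x - e[%classic.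
  apply/seteqP; split => y /=; rewrite !in_itv/= andbT ltr_normr.
    by move=> /orP[?|?]; [right|left]; lra.
  by move=> [?|?]; apply/orP; [right|left]; lra.
have pe : p @^-1` `]x + e, +oo[ = `]e, +oo[%classic.
  by apply/seteqP; split => y /=; rewrite !in_itv/= !andbT ltrD2l.
have qe : q @^-1` `]-oo, x - e[ = `]e, +oo[%classic.
  by apply/seteqP; split => y /=; rewrite !in_itv/= !andbT ltrD2l ltrN2.
have bnd (r : measurableTypeR R -> measurableTypeR R) z : `|u x - u (r z)| <= M + M.
  by rewrite (le_trans (ler_normB _ _))// lerD.
have hr (r : measurableTypeR R -> measurableTypeR R) :
    (forall z, `|x - r z| = `|z|) -> measurable_fun setT r ->
    leb.-integrable `]e, +oo[ (EFin \o (h \o r)) /\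
    leb.-integrable `]e, +oo[ (EFin \o (fun z => (u x - u (r z)) / z `^ (1 + 2 * s))) /\
    \int[leb]_(z in `]e, +oo[) h (r z) =
    \int[leb]_(z in `]e, +oo[) ((u x - u (r z)) / z `^ (1 + 2 * s)).
  move=> rz mr.
  have hE z : z \in (`]e, +oo[%classic : set R) ->
      h (r z) = (u x - u (r z)) / z `^ (1 + 2 * s).
    rewrite inE/= in_itv/= andbT => ez.
    by rewrite /h rz gtr0_norm// (lt_trans e0).
  have ti : leb.-integrable `]e, +oo[
      (EFin \o (fun z => (u x - u (r z)) / z `^ (1 + 2 * s))).
    apply: (@tail_integrable _ _ (M + M)) => //.
    by apply: measurable_funB => //; exact: measurableT_comp.
  split; [|split; [exact: ti|]].
    apply: eq_integrable ti; first exact: measurable_itv.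
    by move=> z ze; rewrite /= hE.
  by apply: eq_Rintegral => z ze; rewrite hE.
have [hp [ip ep]] := hr p (fun z => ltac:(by rewrite /p opprD addrA subrr add0r normrN)) mp.
have [hq [iq eq_]] := hr q (fun z => ltac:(by rewrite /q opprB addrC subrK)) mq.
have := Rintegral_measure_preserving mp (lebesgue_measure_shift x)
  (measurable_itv `]x + e, +oo[) mh.
rewrite pe => /(_ hp)[ihp ehp].
have := Rintegral_measure_preserving mq (lebesgue_measure_reflect x)
  (measurable_itv `]-oo, x - e[) mh.
rewrite qe => /(_ hq)[ihq ehq].
have ih : leb.-integrable (`]x + e, +oo[ `|` `]-oo, x - e[) (EFin \o h).
  apply: integrable_setU; [exact: measurable_itv|exact: measurable_itv|exact: dis
    |exact: ihp|exact: ihq].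
rewrite Rintegral_setU; [|exact: measurable_itv|exact: measurable_itv|exact: ih|exact: dis].
rewrite ehp ehq ep eq_ -RintegralD; [|exact: measurable_itv|exact: ip|exact: iq].
by apply: eq_Rintegral => z _; rewrite -mulrDl /sdiff /p /q; congr (_ / _); ring.
Qed.

(** Once the kernel is absolutely integrable on [z > 0], the limit of the
    truncations follows by dominated convergence. *)
Lemma frac_laplacianE a s u x : admissible a u -> 0 < s -> 2 * s < a + 1 ->
  frac_laplacian s u x = kernel_integral s u x.
Proof.
move=> au s0 sa.
pose t := Num.min (a + 1 - 2 * s) (2 * s).
have t0 : 0 < t by rewrite lt_min subr_gt0 sa mulr_gt0.
have tas : t <= a + 1 - 2 * s by rewrite ge_min lexx.
have ts : t <= 2 * s by rewrite ge_min lexx orbT.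
have iF := kernel_integrable x au t0 tas ts.
rewrite /frac_laplacian /kernel_integral.
set F := (fun z => _) in iF *.
apply: cvg_lim; first exact: Rhausdorff.
apply/cvg_at_rightP => e [e0 ecvg].
have [cu Mu _] := au.
rewrite (_ : (fun n => _) = (fun n => \int[leb]_(z in `]0, +oo[) (F \_ `]e n, +oo[) z)); last first.
  apply/funext => n; rewrite truncated_kernel// -Rintegral_mkcondr.
  congr (Rintegral _ _ _); apply/seteqP; split => z /=; rewrite !in_itv/= !andbT.
    by move=> ez; rewrite ez (lt_trans _ ez).
  by case.
apply: fine_cvg; rewrite fineK; last exact: integrable_fin_num.
apply: (@dominated_cvg _ _ _ leb _ _ (fun n => EFin \o (F \_ `]e n, +oo[)) _
   (abse \o (EFin \o F))) => //.
- move=> n; apply: measurableT_comp => //; apply: measurable_funTS.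
  apply/(measurable_restrictT F) => //; apply: measurable_funTS.
  apply: measurable_kernel; apply: continuous_measurable_fun.
  exact: sdiff_continuous.
- move=> z; rewrite /= in_itv/= andbT => z0; apply: cvg_EFin; first exact: nearW.
  apply: cvg_near_cst; near=> n; rewrite /= patchE ifT// inE/= in_itv/= andbT.
  near: n; exact: (cvgr_lt 0).
- exact: integrable_abse.
- move=> n z _; rewrite /= lee_fin patchE; case: ifP => // _.
  by rewrite normr0.
Unshelve. all: by end_near. Qed.

End principal_value.

(** * Mixing the orders *)

Section mixing.
Context {R : realType}.
Implicit Types (a s t x z : R) (u v : R -> R).
Local Notation leb := (@lebesgue_measure R).

Lemma powR_exponent_continuous z : 0 < z -> continuous (fun s => z `^ s).
Proof.
move=> z0 s; rewrite /powR gt_eqF//.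
apply: (@continuous_comp _ _ _ (fun s => s * ln z) expR); last exact: continuous_expR.
by apply: cvgM; [exact: cvg_id|exact: cvg_cst].
Qed.

(** The open interval of orders is what makes continuity in [s], and hence
    measurability, available on the closed interval [[s1, s2]]. *)
Lemma kernel_dominated a s1 s2 u x :
  1 / 2 <= s1 -> s1 <= s2 -> 2 * s2 - 1 < a -> admissible a u ->
  exists p q : R, [/\ p < s1, s2 < q &
    exists2 g : R -> R, leb.-integrable `]0, +oo[ (EFin \o g) &
    forall s, p < s < q ->
      leb.-integrable `]0, +oo[
        (EFin \o (fun z => sdiff u x z / z `^ (1 + 2 * s))) /\
      forall z, 0 < z -> `|sdiff u x z / z `^ (1 + 2 * s)| <= g z].
Proof.
move=> s1h s12 s2a au; have [C C0 uC] := sdiff_bound x au.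
pose t := Num.min ((a + 1 - 2 * s2) / 2) (1 / 2).
have t0 : 0 < t by rewrite lt_min; apply/andP; split; lra.
have ta : t <= (a + 1 - 2 * s2) / 2 by rewrite ge_min lexx.
have th : t <= 1 / 2 by rewrite ge_min lexx orbT.
(* [1 / 4] is below [s1] and keeps [t <= 1 / 2 <= 2 s]; raising the
   order above [s2] by [t / 2] costs [t] of the gap [a + 1 - 2 s2 >= 2 t]. *)
exists (1 / 4), (s2 + t / 2); split; [lra|lra|].
exists (fun z => C * (4 / t) * majorant t z).
  have : leb.-integrable `]0, +oo[
      (fun z => (C * (4 / t))%:E * (EFin \o majorant t) z)%E.
    by apply: integrableZl => //; exact: majorant_integrable.
  exact.
move=> s /andP[ps sq].
have tas : t <= a + 1 - 2 * s by lra.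
have ts : t <= 2 * s by lra.
split; first exact: kernel_integrable au t0 tas ts.
by move=> z z0; rewrite -mulrA; exact: uC.
Qed.

Variables (a s1 s2 : R).
Hypotheses (s1h : 1 / 2 <= s1) (s12 : s1 <= s2) (s2a : 2 * s2 - 1 < a).
Variable mu : probability (measurableTypeR R) R.

Lemma kernel_integral_mu_integrable u x : admissible a u ->
  mu.-integrable `[s1, s2] (EFin \o (fun s => kernel_integral s u x)).
Proof.
move=> au; have [p [q [ps qs [g ig gP]]]] := kernel_dominated x s1h s12 s2a au.
have sub s : s1 <= s <= s2 -> p < s < q.
  by move=> /andP[a1 a2]; rewrite (lt_le_trans ps)//= (le_lt_trans a2).
have ck : {in (`]p, q[%classic : set R), continuous (fun s => kernel_integral s u x)}.
  apply: (@continuity_under_integral _ _ _ leb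
      (fun s z => sdiff u x z / z `^ (1 + 2 * s)) _ (measurable_pos)
      p q _ _ g ig _).
  - by move=> s; rewrite /= in_itv/= => /gP[].
  - apply: aeW => z; rewrite /= in_itv/= andbT => z0 s _.
    apply: cvgM; first exact: cvg_cst.
    apply: cvgV; first by rewrite gt_eqF// powR_gt0.
    apply: (@continuous_comp _ _ _ (fun s => 1 + 2 * s) (fun s => z `^ s)).
      by apply: cvgD; [exact: cvg_cst|apply: cvgM; [exact: cvg_cst|exact: cvg_id]].
    exact: powR_exponent_continuous.
  - move=> s; rewrite /= in_itv/= => /gP[_ gz]; apply: aeW => z.
    by rewrite /= in_itv/= andbT; exact: gz.
apply: measurable_bounded_integrable => //.
- by rewrite (le_lt_trans (probability_le1 mu _))// ltry.
- have : measurable_fun (`]p, q[%classic : set R) (fun s => kernel_integral s u x).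
    by apply: open_continuous_measurable_fun => //; exact: interval_open.
  apply: measurable_funS => // s; rewrite /= !in_itv/=; exact: sub.
- exists (\int[leb]_(z in `]0, +oo[) g z); split; first exact: num_real.
  move=> M gM s; rewrite /= in_itv/= => /sub/gP[ik kg].
  apply: le_trans (ltW gM); apply: le_trans (le_normr_Rintegral _ ik) _ => //.
  apply: le_Rintegral => //; first exact: integrable_norm.
  by move=> z; rewrite /= in_itv/= andbT; exact: kg.
Qed.

Lemma mixed_laplacianE u x : admissible a u ->
  mixed_laplacian mu s1 s2 u x = \int[mu]_(s in `[s1, s2]) kernel_integral s u x.
Proof.
move=> au.
have E (s : R) : s1 <= s -> s <= s2 -> frac_laplacian s u x = kernel_integral s u x.
  move=> h1 h2; move: (s1h) (s2a) => ? ?; have s0 : 0 < s by lra.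
  have sa : 2 * s < a + 1 by lra.
  exact: frac_laplacianE au s0 sa.
by apply: eq_Rintegral => s; rewrite inE/= in_itv/= => /andP[? ?]; exact: E.
Qed.

Lemma admissible_lincomb k u v : admissible a u -> admissible a v ->
  admissible a (fun x => u x - k * v x).
Proof.
move=> [cu [M uM] uC] [cv [N vN] vC]; split.
- move=> x; apply: cvgB; first exact: cu.
  by apply: cvgM; [exact: cvg_cst|exact: cv].
- exists (M + `|k| * N) => x; rewrite (le_trans (ler_normB _ _))//.
  by rewrite lerD// normrM ler_wpM2l.
- move=> x; have [C {}uC] := uC x; have [D {}vC] := vC x.
  exists (C + `|k| * D) => z z0 z1.
  have -> : sdiff (fun x => u x - k * v x) x z = sdiff u x z - k * sdiff v x z.
    by rewrite /sdiff; ring.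
  rewrite (le_trans (ler_normB _ _))// mulrDl lerD//; first exact: uC.
  by rewrite normrM -mulrA ler_wpM2l// vC.
Qed.

(** Linearity is not formal: each of the two integrals, in [z] and in [s], has to
    be known to converge absolutely. *)
Lemma mixed_laplacian_lincomb k u v x : admissible a u -> admissible a v ->
  mixed_laplacian mu s1 s2 (fun x => u x - k * v x) x =
  mixed_laplacian mu s1 s2 u x - k * mixed_laplacian mu s1 s2 v x.
Proof.
move=> au av; have auv := admissible_lincomb k au av.
rewrite !mixed_laplacianE//.
have iu := kernel_integral_mu_integrable x au.
have iv := kernel_integral_mu_integrable x av.
rewrite -RintegralZl//.
rewrite -RintegralB//; last first.
  exact: (integrableZl _ k iv).
apply: eq_Rintegral => s; rewrite inE/= in_itv/= => ss.
have [p [q [ps qs [g ig gP]]]] := kernel_dominated x s1h s12 s2a au.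
have [p' [q' [ps' qs' [g' ig' gP']]]] := kernel_dominated x s1h s12 s2a av.
have /andP[ss1 ss2] := ss.
have [iku _] : _ := gP s (ltac:(by rewrite (lt_le_trans ps)//= (le_lt_trans ss2))).
have [ikv _] : _ := gP' s (ltac:(by rewrite (lt_le_trans ps')//= (le_lt_trans ss2))).
rewrite /kernel_integral -RintegralZl//.
rewrite -RintegralB//; last first.
  exact: (integrableZl _ k ikv).
by apply: eq_Rintegral => z _; rewrite mulrA -mulrBl; congr (_ / _); rewrite /sdiff; ring.
Qed.

Lemma mixed_laplacian_ge m u x : mu [set` `[s1, s2]] = 1%E -> admissible a u ->
  (forall s, s1 <= s <= s2 -> m <= kernel_integral s u x) ->
  m <= mixed_laplacian mu s1 s2 u x.
Proof.
move=> mu1 au mk; rewrite mixed_laplacianE//.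
have -> : m = \int[mu]_(s in `[s1, s2]) m.
  by rewrite Rintegral_cst// /= mu1 mulr1.
apply: le_Rintegral => //.
- by apply: finite_measure_integrable_cst.
- exact: kernel_integral_mu_integrable.
Qed.

End mixing.

(** * Regular functions and the bump *)

Section regularity.
Context {R : realType}.
Implicit Types (a z x : R) (u : R -> R).

Lemma admissible_weaken a b u : a <= b -> admissible b u -> admissible a u.
Proof.
move=> ab [cu bu uC]; split=> // x; have [C {}uC] := uC x.
exists `|C| => z z0 z1; apply: (le_trans (uC z z0 z1)).
apply: (@le_trans _ _ (`|C| * z `^ (1 + b))).
  by rewrite ler_wpM2r ?powR_ge0// ler_norm.
by rewrite ler_wpM2l// ger_powR ?z0// lerD2l.
Qed.

(** By the mean value theorem the second difference is
    [(u' y1 - u' y2) z] with [y1] and [y2] at distance at most [2 z]. *)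
Lemma is_C1_holder_admissible a u :
  0 <= a -> is_C1_holder a u -> bounded_fun u -> admissible a u.
Proof.
move=> a0 [[du _] hu] bu.
have cu : continuous u.
  by move=> x; apply/differentiable_continuous/derivable1_diffP.
split => //.
  move: bu => [M [Mr Mu]]; exists (M + 1) => x; apply: Mu => //.
  by rewrite ltrDl.
move=> x; have [M uM] := hu (`|x| + 1).
exists (`|M| * 2 `^ a) => z z0 z1.
have isd (y : R) : is_derive y 1 u (derive1 u y).
  by rewrite derive1E; apply/derivableP.
have mvt p q : p < q -> exists2 y, p <= y <= q & u q - u p = derive1 u y * (q - p).
  move=> pq; have [|y] := @MVT _ u (derive1 u) p q pq (fun y _ => isd y).
    exact: continuous_subspaceT.
  rewrite in_itv/= => /andP[py yq] e; exists y => //.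
  by rewrite (ltW py) (ltW yq).
have [|y1 /andP[y1a y1b] e1] := mvt (x - z) x; first by rewrite ltrBlDr ltrDl.
have [|y2 /andP[y2a y2b] e2] := mvt x (x + z); first by rewrite ltrDl.
have [xl xu] : - `|x| <= x /\ x <= `|x| by apply/andP; rewrite -ler_norml.
have hold : `|derive1 u y1 - derive1 u y2| <= `|M| * 2 `^ a * z `^ a.
  apply: (@le_trans _ _ (M * `|y1 - y2| `^ a)).
    by apply: uM; rewrite in_itv/=; apply/andP; split; lra.
  apply: (@le_trans _ _ (`|M| * `|y1 - y2| `^ a)).
    by rewrite ler_wpM2r ?powR_ge0// ler_norm.
  rewrite -mulrA -powRM ?(ltW z0)// ler_wpM2l// ge0_ler_powR ?nnegrE//.
    by rewrite mulr_ge0// ltW.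
  by rewrite ler_norml; apply/andP; split; lra.
have -> : sdiff u x z = (derive1 u y1 - derive1 u y2) * z.
  rewrite mulrBl; have -> : derive1 u y1 * z = u x - u (x - z).
    by rewrite e1; congr (_ * _); ring.
  have -> : derive1 u y2 * z = u (x + z) - u x.
    by rewrite e2; congr (_ * _); ring.
  by rewrite /sdiff; ring.
rewrite normrM (gtr0_norm z0) powRD ?(gt_eqF z0) ?implybT// powRr1 ?(ltW z0)//.
by rewrite [z * _]mulrC mulrA ler_wpM2r// ltW.
Qed.

End regularity.

Section bump.
Context {R : realType}.
Implicit Types (x z : R).
Local Notation leb := (@lebesgue_measure R).

(** The second difference of this rational function is again explicit, which
    gives a bound uniform in the base point. *)
Definition bump (x : R) : R := (1 + x ^+ 2)^-1.

Lemma bump_gt0 x : 0 < bump x.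
Proof. by rewrite invr_gt0 ltr_wpDr// sqr_ge0. Qed.

Lemma bump_le1 x : bump x <= 1.
Proof. by rewrite invf_le1 ?lerDl ?sqr_ge0// ltr_wpDr// sqr_ge0. Qed.

Lemma bump0 : bump 0 = 1.
Proof. by rewrite /bump expr0n/= addr0 invr1. Qed.

Lemma bump_le_half x : 1 <= `|x| -> bump x <= 1 / 2.
Proof.
move=> x1; rewrite /bump div1r lef_pV2 ?posrE// ?ltr_wpDr ?sqr_ge0//.
have : 1 <= x ^+ 2 by rewrite -real_normK ?num_real// expr_ge1.
lra.
Qed.

Lemma bump_continuous : continuous bump.
Proof.
move=> x; apply: cvgV; first by rewrite gt_eqF// ltr_wpDr// sqr_ge0.
by apply: cvgD; [exact: cvg_cst|exact: exprn_continuous].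
Qed.

(** The bound does not depend on [x]; this makes the operator applied to a
    translated bump bounded uniformly in the translation. *)
Lemma sdiff_bump_le x z : sdiff bump x z <= 2 * z ^+ 2.
Proof.
rewrite /sdiff /bump.
set A := 1 + x ^+ 2; set P := 1 + (x + z) ^+ 2; set Q := 1 + (x - z) ^+ 2.
have A1 : 1 <= A by rewrite lerDl sqr_ge0.
have P1 : 1 <= P by rewrite lerDl sqr_ge0.
have Q1 : 1 <= Q by rewrite lerDl sqr_ge0.
have A0 : A != 0 by rewrite gt_eqF// (lt_le_trans ltr01).
have P0 : P != 0 by rewrite gt_eqF// (lt_le_trans ltr01).
have Q0 : Q != 0 by rewrite gt_eqF// (lt_le_trans ltr01).
have -> : 2 / A - P^-1 - Q^-1 =
    2 * z ^+ 2 * (1 + z ^+ 2 - 3 * x ^+ 2) / (A * P * Q).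
  rewrite /A /P /Q in A0 P0 Q0 *.
  by field; rewrite A0 P0 Q0.
have APQ : P * Q <= A * P * Q.
  by rewrite -mulrA ler_peMl// mulr_ge0// (le_trans ler01).
have PQ : 1 + z ^+ 2 <= P * Q.
  have -> : P * Q = 1 + 2 * (x ^+ 2 + z ^+ 2) + (x ^+ 2 - z ^+ 2) ^+ 2.
    by rewrite /P /Q; ring.
  have := sqr_ge0 (x ^+ 2 - z ^+ 2); have := sqr_ge0 x; have := sqr_ge0 z.
  lra.
have ratio : (1 + z ^+ 2 - 3 * x ^+ 2) / (A * P * Q) <= 1.
  have := sqr_ge0 z; have := sqr_ge0 x => x2 z2.
  by rewrite ler_pdivrMr ?mul1r; lra.
by rewrite -mulrA ler_piMr// mulr_ge0// sqr_ge0.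
Qed.

End bump.

(** * Maximum principles *)

Section principles.
Context {R : realType}.
Variables (s1 s2 a : R).
Hypotheses (s1h : 1 / 2 <= s1) (s12 : s1 <= s2) (s2lt1 : s2 < 1)
  (s2a : 2 * s2 - 1 < a).
Variable mu : probability (measurableTypeR R) R.
Hypothesis mu1 : mu [set` `[s1, s2]] = 1%E.
Implicit Types (x z : R) (v : R -> R).
Local Notation leb := (@lebesgue_measure R).

Lemma order_kernel_integrable s v x : s1 <= s <= s2 -> admissible a v ->
  leb.-integrable `]0, +oo[
    (EFin \o (fun z => sdiff v x z / z `^ (1 + 2 * s))).
Proof.
move=> /andP[ss1 ss2] av.
have [p [q [ps qs [g ig gP]]]] := kernel_dominated x s1h s12 s2a av.
by case: (gP s) => //; rewrite (lt_le_trans ps)//= (le_lt_trans ss2).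
Qed.

(** If adding [e] times a bump gives a function with a maximum at [x], then the
    operator at [x] is at least [- e K], with [K] the same for all orders in
    [[s1, s2]] and all positions of the bump. *)
Lemma kernel_integral_ge_bump : exists2 K : R, 0 <= K &
  forall e s v x y, 0 <= e -> s1 <= s <= s2 -> admissible a v ->
    (forall z, 0 < z -> - (e * sdiff bump y z) <= sdiff v x z) ->
    - (e * K) <= kernel_integral s v x.
Proof.
move: (s1h) (s2lt1) => s1h' s2lt1'.
(* The second difference of the bump is at most [min 2 (2 z^2)], the case
   [a = 1] of [kernel_bound]. *)
pose t := Num.min (2 - 2 * s2) 1.
have t0 : 0 < t by rewrite lt_min; apply/andP; split; lra.
have t2 : t <= 2 - 2 * s2 by rewrite ge_min lexx.
have t1 : t <= 1 by rewrite ge_min lexx orbT.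
pose g z := 2 * (4 / t) * majorant t z.
have g0 z : 0 <= g z.
  by rewrite /g mulr_ge0 ?majorant_ge0 ?(ltW t0)// mulr_ge0// divr_ge0// ltW.
have ig : leb.-integrable `]0, +oo[ (EFin \o g).
  exact: (integrableZl _ (2 * (4 / t)) (majorant_integrable t0)).
exists (\int[leb]_(z in `]0, +oo[) g z).
  by apply: Rintegral_ge0 => z _; exact: g0.
move=> e s v x y e0 ss av hv.
rewrite -mulNr -RintegralZl; [|exact: measurable_pos|exact: ig].
apply: le_Rintegral; first exact: measurable_pos.
- exact: (integrableZl _ (- e) ig).
- exact: order_kernel_integrable ss av.
move=> z; rewrite /= in_itv/= andbT => z0.
have /andP[ss1 ss2] := ss.
have zs0 : 0 < z `^ (1 + 2 * s) by rewrite powR_gt0.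
apply: (@le_trans _ _ (- (e * sdiff bump y z) / z `^ (1 + 2 * s))); last first.
  by rewrite ler_pM2r ?invr_gt0// hv.
rewrite mulNr mulNr lerN2 -mulrA ler_wpM2l//.
have bz : sdiff bump y z <= Num.min 2 (2 * z ^+ 2).
  rewrite le_min sdiff_bump_le andbT /sdiff.
  have := bump_le1 y; have := bump_gt0 (y + z); have := bump_gt0 (y - z).
  by move=> ? ? ?; lra.
apply: (@le_trans _ _ (Num.min 2 (2 * z ^+ 2) / z `^ (1 + 2 * s))).
  by rewrite ler_pM2r ?invr_gt0.
apply: le_trans (ler_norm _) _; rewrite /g -mulrA.
have m0 : 0 <= Num.min 2 (2 * z ^+ 2) :> R by rewrite le_min ler0n/= mulr_ge0// sqr_ge0.
apply: (kernel_bound (a := 1)) => //; [lra|lra| |].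
- by rewrite ger0_norm// ge_min lexx.
- move=> z1; rewrite ger0_norm// ge_min; apply/orP; right.
  by rewrite -[1 + 1]/(2%:R) powR_mulrn// ltW.
Qed.

(** The supremum of [v] need not be attained; a small bump placed where [v] is
    nearly maximal forces the perturbed function to attain its maximum. *)
Lemma maximum_principle (c v : R -> R) (c0 R0 : R) : 0 < c0 ->
  (forall x, x \notin `[- R0, R0] -> c x <= - c0) ->
  admissible a v ->
  (forall x, mixed_laplacian mu s1 s2 v x = c x * v x) ->
  (forall x, x \in `[- R0, R0] -> v x <= 0) ->
  forall x, v x <= 0.
Proof.
move=> c00 hc av eqv vin y; rewrite leNgt; apply/negP => vy.
have [K K0 hK] := kernel_integral_ge_bump.
have [cv [B vB] _] := av.
have hub : has_ubound (range v).
  by exists B => _ [x _ <-]; rewrite (le_trans (ler_norm _)).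
have hsup : has_sup (range v) by split=> //; exists (v y), y.
pose M := sup (range v).
have vM x : v x <= M by apply: ub_le_sup => //; exists x.
have M0 : 0 < M by exact: lt_le_trans (vM y).
(* Small enough for [2 d K < c0 (M - d)]. *)
pose d := Num.min (M / 2) (c0 * M / (4 * (K + 1))).
have K10 : 0 < 4 * (K + 1) by rewrite mulr_gt0// ltr_wpDl.
have d0 : 0 < d by rewrite lt_min !divr_gt0// mulr_gt0.
have dM : d <= M / 2 by rewrite ge_min lexx.
have dK : d * (4 * (K + 1)) <= c0 * M by rewrite -ler_pdivlMr// ge_min lexx orbT.
have [_ [x0 _ <-] Mx0] := sup_adherent d0 hsup.
rewrite -/M in Mx0.
pose f x := v x + 2 * d * bump (x - x0).
have cf : continuous f.
  move=> x; apply: cvgD; first exact: cv.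
  apply: cvgM; first exact: cvg_cst.
  apply: (@continuous_comp _ _ _ (fun x => x - x0) bump).
    by apply: cvgB; [exact: cvg_id|exact: cvg_cst].
  exact: bump_continuous.
have fx0 : f x0 = v x0 + 2 * d by rewrite /f subrr bump0 mulr1.
have le01 : x0 - 1 <= x0 + 1 by lra.
have [x1 x1in fmax] := @EVT_max R f (x0 - 1) (x0 + 1) le01 (continuous_subspaceT cf).
have x0in : x0 \in `[x0 - 1, x0 + 1] by rewrite in_itv/=; apply/andP; split; lra.
have fx01 := fmax _ x0in.
have fle x : f x <= f x1.
  have [xin|] := boolP (x \in `[x0 - 1, x0 + 1]); first exact: fmax.
  (* Farther away the bump has lost half of its height, and [f <= M + d < f x0]. *)
  rewrite in_itv/= -ler_distlC distrC -ltNge => /ltW/bump_le_half bx.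
  apply: le_trans fx01; rewrite fx0 /f.
  have := vM x; have : 2 * d * bump (x - x0) <= 2 * d * (1 / 2).
    by rewrite ler_pM2l// mulr_gt0.
  by move=> ? ?; lra.
have vx1 : M - d < v x1.
  have : 2 * d * bump (x1 - x0) <= 2 * d.
    by rewrite ler_piMr ?bump_le1// mulr_ge0// ltW.
  by move: fx01; rewrite fx0 /f => ? ?; lra.
have vx1_0 : 0 < v x1 by lra.
have x1out : x1 \notin `[- R0, R0].
  by apply/negP => /vin; rewrite leNgt vx1_0.
have : - (2 * d * K) <= mixed_laplacian mu s1 s2 v x1.
  apply: (mixed_laplacian_ge s1h s12 s2a mu1 av) => s ss.
  apply: (hK (2 * d) s v x1 (x1 - x0)) => //; first by rewrite mulr_ge0// ltW.
  move=> z z0; have := fle (x1 + z); have := fle (x1 - z).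
  rewrite /f /sdiff.
  have -> : x1 + z - x0 = x1 - x0 + z by ring.
  have -> : x1 - z - x0 = x1 - x0 - z by ring.
  by move=> ? ?; lra.
rewrite eqv => low.
have : c x1 * v x1 <= - c0 * v x1 by rewrite ler_pM2r// hc.
have : c0 * (M / 2) <= c0 * v x1 by rewrite ler_pM2l//; lra.
by move=> ? ?; nra.
Qed.

(** At a zero [x0] of [v <= 0] all second differences are nonnegative.  If [v]
    is negative at distance [z0] from [x0], they exceed some [k > 0] on
    [[z0, z0 + r]], and the kernel integral is at least a positive constant
    that works for all orders at once. *)
Lemma strong_maximum_principle v x0 : admissible a v ->
  (forall x, v x <= 0) -> v x0 = 0 ->
  mixed_laplacian mu s1 s2 v x0 = 0 ->
  forall x, v x = 0.
Proof.
move=> av v0 vx0 Lv y; apply/eqP; rewrite eq_le v0/= leNgt; apply/negP => vy.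
have [cv _ _] := av.
have D0 z : 0 <= sdiff v x0 z.
  rewrite /sdiff vx0; have := v0 (x0 + z); have := v0 (x0 - z).
  by move=> ? ?; lra.
pose z0 := `|y - x0|.
have z00 : 0 < z0.
  rewrite normr_gt0 subr_eq0; apply: contraTneq vy => ->.
  by rewrite vx0 ltxx.
have Dz0 : 0 < sdiff v x0 z0.
  rewrite /sdiff vx0 /z0.
  have := v0 (x0 + `|y - x0|); have := v0 (x0 - `|y - x0|).
  have yE : x0 + (y - x0) = y by ring.
  have [yx|yx] := ger0P (y - x0); rewrite ?opprK yE => ? ?; lra.
pose k := sdiff v x0 z0 / 2.
have k0 : 0 < k by rewrite divr_gt0.
have [r r0 Dr] : exists2 r, 0 < r & forall z, z0 <= z <= z0 + r -> k <= sdiff v x0 z.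
  have : \forall z \near z0, k < sdiff v x0 z.
    have := @sdiff_continuous R v x0 cv z0.
    by move=> /cvgr_gt; apply; rewrite /k; lra.
  move=> /nbhs_ballP[r /= r0 hr]; exists (r / 2); first by rewrite divr_gt0.
  move=> z /andP[z1 z2]; apply/ltW/hr; rewrite /ball/= distrC ger0_norm ?subr_ge0//.
  by lra.
(* [b >= 1] and [1 + 2 s <= 3], so [z^(1 + 2 s) <= b^3] for all orders. *)
pose b := 1 + z0 + r.
have b0 : 0 < b by rewrite /b; lra.
have b3 : 0 < b `^ 3 by rewrite powR_gt0.
suff : k / b `^ 3 * r <= mixed_laplacian mu s1 s2 v x0.
  by rewrite Lv leNgt mulr_gt0// divr_gt0.
apply: (mixed_laplacian_ge s1h s12 s2a mu1 av) => s ss.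
have iF := order_kernel_integrable x0 ss av.
rewrite /kernel_integral.
set F := (fun z => _) in iF *.
have F0 z : 0 <= F z by rewrite /F divr_ge0// powR_ge0.
have sub : `[z0, z0 + r] `<=` (`]0, +oo[ : set R).
  by move=> z; rewrite /= !in_itv/= andbT => /andP[/(lt_le_trans z00)].
have mF : measurable_fun (`]0, +oo[ : set R) (EFin \o F).
  by case/integrableP : iF.
rewrite -lee_fin fineK; last exact: (integrable_fin_num _ iF).
have low : ((k / b `^ 3 * r)%:E <= \int[leb]_(z in `[z0, (z0 + r)%R]) (k / b `^ 3)%:E)%E.
  have lm : leb `[z0, (z0 + r)%R] = r%:E.
    by rewrite lebesgue_measure_itv/= lte_fin ltrDl r0 -EFinB addrAC subrr add0r.
  rewrite integral_cst; last exact: measurable_itv.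
  by rewrite EFinM -lm.
apply: (le_trans low).
apply: (@le_trans _ _ (\int[leb]_(z in `[z0, (z0 + r)%R]) (F z)%:E)%E).
  apply: ge0_le_integral; first exact: measurable_itv.
  - by move=> z _; rewrite lee_fin divr_ge0// ltW.
  - exact: measurable_cst.
  - by apply: measurable_funS sub mF; exact: measurable_itv.
  - move=> z zin; rewrite lee_fin /F.
    have zp : 0 < z by move: (sub _ zin); rewrite /= in_itv/= andbT.
    move: zin; rewrite /= in_itv/= => zin.
    have zb : z `^ (1 + 2 * s) <= b `^ 3.
      have /andP[? ?] := ss; have /andP[? ?] := zin.
      move: (s1h) (s2lt1) => ? ?.
      apply: (@le_trans _ _ (b `^ (1 + 2 * s))).
        rewrite ge0_ler_powR ?nnegrE ?(ltW zp) ?(ltW b0)//; first by lra.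
        by rewrite /b; lra.
      by rewrite ler_powR//; [rewrite /b; lra|lra].
    apply: ler_pM; rewrite ?invr_ge0 ?(ltW k0) ?(ltW b3) ?Dr//.
    by rewrite lef_pV2 ?posrE ?powR_gt0.
by apply: ge0_subset_integral => // z _; rewrite lee_fin.
Qed.

End principles.

(** * Uniqueness up to a multiple *)

Theorem corollary5p3 (R : realType) (s1 s2 : R)
    (hs1 : 1 / 2 <= s1) (hs12 : s1 <= s2) (hs2 : s2 < 1)
    (mu : probability (measurableTypeR R) R) (hmu : mu [set` `[s1, s2]] = 1%E)
    (c : R -> R) (hc_bounded : bounded_fun c)
    (hc_neg : exists c0 R0 : R, [/\ 0 < c0, 0 < R0
       & forall x : R, x \notin `[- R0, R0] -> c x <= - c0])
    (hc_C1 : is_C1 c) (hc_norm : (C1_holder_norm (2 * s2 - 1) c < +oo)%E)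
    (w wt : R -> R)
    (hw_bounded : bounded_fun w) (hwt_bounded : bounded_fun wt)
    (hw : is_solution mu s1 s2 c w) (hwt : is_solution mu s1 s2 c wt)
    (hw_pos : forall x : R, 0 < w x) :
  exists k : R, forall x : R, wt x / w x = k.
Proof.
have [c0 [R0 [c00 R00 hc]]] := hc_neg.
have [[a [sa _ ha]] eqw] := hw; have [[b [sb _ hb]] eqwt] := hwt.
have a0 : 0 <= a by lra.
have b0 : 0 <= b by lra.
pose t := Num.min a b.
have st : 2 * s2 - 1 < t by rewrite lt_min sa.
have aw : admissible t w.
  apply: (@admissible_weaken _ _ a); first by rewrite ge_min lexx.
  exact: is_C1_holder_admissible.
have awt : admissible t wt.
  apply: (@admissible_weaken _ _ b); first by rewrite ge_min lexx orbT.
  exact: is_C1_holder_admissible.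
have w0 x : w x != 0 by rewrite gt_eqF.
have [cw _ _] := aw; have [cwt _ _] := awt.
have cr : continuous (fun x => wt x / w x).
  by move=> x; apply: cvgM; [exact: cwt|apply: cvgV; [exact: w0|exact: cw]].
have [|x0 x0in kmax] := @EVT_max R _ (- R0) R0 _ (continuous_subspaceT cr).
  by lra.
exists (wt x0 / w x0); set k := wt x0 / w x0.
pose v x := wt x - k * w x.
have av : admissible t v by exact: admissible_lincomb.
have eqv x : mixed_laplacian mu s1 s2 v x = c x * v x.
  rewrite (mixed_laplacian_lincomb hs1 hs12 st)// /v.
  have /eqP := eqw x; rewrite subr_eq0 => /eqP ->.
  have /eqP := eqwt x; rewrite subr_eq0 => /eqP ->.
  by ring.
have vin x : x \in `[- R0, R0] -> v x <= 0.
  by move=> /kmax; rewrite -/k ler_pdivrMr// subr_le0.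
have v0 := maximum_principle hs1 hs12 hs2 st hmu c00 hc av eqv vin.
have vx0 : v x0 = 0 by rewrite /v /k divfK// subrr.
have vE := strong_maximum_principle hs1 hs12 hs2 st hmu av v0 vx0.
move=> x; apply: (mulIf (w0 x)); rewrite divfK//.
by apply/eqP; rewrite -subr_eq0; apply/eqP/vE; rewrite eqv vx0 mulr0.
Qed.
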